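(* Let $(L,[-,-,-])$ be a ternary Leibniz algebra, $(M,l_1,l_2,l_3)$ a bimodule over $L$, and $\omega:L\times L\times L\to M$ a $2$-cocycle on $L$ with values in $M$. Then $L\oplus M$ is a ternary Leibniz algebra with the bracket $$[x+m_1,y+m_2,z+m_3]_\omega=[x,y,z]+l_1(m_1,y,z)+l_2(x,m_2,z)+l_3(x,y,m_3)+\omega(x,y,z),$$ for all $x,y,z\in L$, $m_1,m_2,m_3\in M$. Moreover, the brackets $[-,-,-]_0$ and $[-,-,-]_\omega$ on $L\oplus M$ are compatible, where $0:L\times L\times L\to M$ is the null $2$-cocycle.
   Context: Vector spaces are over a field $\mathbb{K}$. A ternary Leibniz algebra is a vector space $L$ with a trilinear map $[-,-,-]:L\times L\times L\to L$ such that $[[x,y,z],t,u]=[x,y,[z,t,u]]+[x,[y,t,u],z]+[[x,t,u],y,z]$ for all $x,y,z,t,u\in L$. Two ternary Leibniz brackets $[-,-,-]_1,[-,-,-]_2$ on the same vector space are compatible if for all $x,y,z,t,u$: $$[[x,y,z]_1,t,u]_2+[[x,y,z]_2,t,u]_1=[x,y,[z,t,u]_1]_2+[x,y,[z,t,u]_2]_1+[x,[y,t,u]_1,z]_2+[x,[y,t,u]_2,z]_1+[[x,t,u]_1,y,z]_2+[[x,t,u]_2,y,z]_1.$$ A bimodule over a ternary Leibniz algebra $L$ is a vector space $M$ with trilinear maps $l_1:M\times L\times L\to M$, $l_2:L\times M\times L\to M$, $l_3:L\times L\times M\to M$ such that for all $x,y,z,t\in L$, $m\in M$: $$l_1(l_1(m,x,y),z,t)=l_1(m,x,[y,z,t])+l_1(m,[x,z,t],y)+l_1(l_1(m,z,t),x,y),$$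 $$l_1(l_2(x,m,y),z,t)=l_2(x,m,[y,z,t])+l_2(x,l_1(m,z,t),y)+l_2([x,z,t],m,y),$$ $$l_1(l_3(x,y,m),z,t)=l_3(x,y,l_1(m,z,t))+l_3(x,[y,z,t],m)+l_3([x,z,t],y,m),$$ $$l_2([x,y,z],m,t)=l_3(x,y,l_2(z,m,t))+l_2(x,l_2(y,m,t),z)+l_1(l_2(x,m,t),y,z),$$ $$l_3([x,y,z],t,m)=l_3(x,y,l_3(z,t,m))+l_2(x,l_3(y,t,m),z)+l_1(l_3(x,t,m),y,z).$$ A trilinear map $\omega:L\times L\times L\to M$ is a $2$-cocycle on $L$ with values in $M$ if for all $x,y,z,t,u\in L$: $$l_1(\omega(x,y,z),t,u)+\omega([x,y,z],t,u)=l_3(x,y,\omega(z,t,u))+l_2(x,\omega(y,t,u),z)+l_1(\omega(x,t,u),y,z)+\omega(x,y,[z,t,u])+\omega(x,[y,t,u],z)+\omega([x,t,u],y,z).$$ *)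

(* Defs.v *)
From mathcomp Require Import all_boot all_algebra.
Set Implicit Arguments.
Unset Strict Implicit.
Unset Printing Implicit Defensive.
Import GRing.Theory.
Local Open Scope ring_scope.

Definition trilinear (K : fieldType) (U V W X : lmodType K)
    (f : U -> V -> W -> X) : Prop :=
  [/\ forall v w, linear (fun u => f u v w),
      forall u w, linear (fun v => f u v w)
    & forall u v, linear (fun w => f u v w)].

Record ternary_leibniz (K : fieldType) (L : lmodType K)
    (br : L -> L -> L -> L) : Prop := TernaryLeibniz {
  leibniz_trilinear : trilinear br;
  leibniz_identity : forall x y z t u : L,
    br (br x y z) t u =
      br x y (br z t u) + br x (br y t u) z + br (br x t u) y z
}.

Record compatible (K : fieldType) (L : lmodType K)
    (br1 br2 : L -> L -> L -> L) : Prop := Compatible {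
  compatible_left : ternary_leibniz br1;
  compatible_right : ternary_leibniz br2;
  compatible_identity : forall x y z t u : L,
    br2 (br1 x y z) t u + br1 (br2 x y z) t u =
      br2 x y (br1 z t u) + br1 x y (br2 z t u)
      + br2 x (br1 y t u) z + br1 x (br2 y t u) z
      + br2 (br1 x t u) y z + br1 (br2 x t u) y z
}.

Record bimodule (K : fieldType) (L M : lmodType K) (br : L -> L -> L -> L)
    (l1 : M -> L -> L -> M) (l2 : L -> M -> L -> M) (l3 : L -> L -> M -> M)
    : Prop := Bimodule {
  bimodule_trilinear1 : trilinear l1;
  bimodule_trilinear2 : trilinear l2;
  bimodule_trilinear3 : trilinear l3;
  bimodule_l1l1 : forall (m : M) (x y z t : L),
    l1 (l1 m x y) z t =
      l1 m x (br y z t) + l1 m (br x z t) y + l1 (l1 m z t) x y;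
  bimodule_l1l2 : forall (m : M) (x y z t : L),
    l1 (l2 x m y) z t =
      l2 x m (br y z t) + l2 x (l1 m z t) y + l2 (br x z t) m y;
  bimodule_l1l3 : forall (m : M) (x y z t : L),
    l1 (l3 x y m) z t =
      l3 x y (l1 m z t) + l3 x (br y z t) m + l3 (br x z t) y m;
  bimodule_l2 : forall (m : M) (x y z t : L),
    l2 (br x y z) m t =
      l3 x y (l2 z m t) + l2 x (l2 y m t) z + l1 (l2 x m t) y z;
  bimodule_l3 : forall (m : M) (x y z t : L),
    l3 (br x y z) t m =
      l3 x y (l3 z t m) + l2 x (l3 y t m) z + l1 (l3 x t m) y z
}.

Record cocycle2 (K : fieldType) (L M : lmodType K) (br : L -> L -> L -> L)
    (l1 : M -> L -> L -> M) (l2 : L -> M -> L -> M) (l3 : L -> L -> M -> M)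
    (omega : L -> L -> L -> M) : Prop := Cocycle2 {
  cocycle2_trilinear : trilinear omega;
  cocycle2_identity : forall x y z t u : L,
    l1 (omega x y z) t u + omega (br x y z) t u =
      l3 x y (omega z t u) + l2 x (omega y t u) z + l1 (omega x t u) y z
      + omega x y (br z t u) + omega x (br y t u) z + omega (br x t u) y z
}.

(* The direct sum of L and M is the product L * M: x + m is the pair (x, m). *)
Definition twisted_bracket (K : fieldType) (L M : lmodType K)
    (br : L -> L -> L -> L)
    (l1 : M -> L -> L -> M) (l2 : L -> M -> L -> M) (l3 : L -> L -> M -> M)
    (omega : L -> L -> L -> M) (a b c : L * M) : L * M :=
  (br a.1 b.1 c.1,
   l1 a.2 b.1 c.1 + l2 a.1 b.2 c.1 + l3 a.1 b.1 c.2 + omega a.1 b.1 c.1).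

(* Main.v *)
Require Import Defs.
From mathcomp Require Import all_boot all_algebra.
Import GRing.Theory.
Local Open Scope ring_scope.

(** The [L]-component of the twisted bracket is [br] itself, so everything
    happens in the [M]-component.

    Leibniz identity.  The [M]-component of a bracket is a sum of one term for
    each of the three arguments, in which that argument contributes its
    [M]-part, and of the twist [omega].  After expansion by additivity, the
    identity for [x + m1], ..., [u + m5] is therefore a sum of six independent
    identities: the one linear in [mi] is the [i]-th bimodule axiom, and the
    one free of [m]'s is the cocycle identity.  The right-hand side of a bimodule
    axiom has three terms, one from each of the three nested brackets on the
    right of the Leibniz identity; that of the cocycle identity has six, two
    from each (see [twisted_leibniz_identity]).

    Compatibility.  The difference [d] of two twisted brackets takes its values
    in [M] and vanishes as soon as one argument is in [M], so nesting [d] in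
    itself gives zero, in any of the three positions.  Polarizing, the mixed
    nestings of the two brackets add up to the pure ones ([twisted_polar1] to
    [twisted_polar3]).  The compatibility identity is thus the sum of the two
    Leibniz identities; this holds for any two cocycles, in particular for the
    null cocycle and [omega]. *)

Section TrilinearMaps.

Set Implicit Arguments.
Unset Strict Implicit.

Variables (K : fieldType) (U V W X : lmodType K) (f : U -> V -> W -> X).
Hypothesis f_lin : trilinear f.

Lemma trilinear1P a u u' v w : f (a *: u + u') v w = a *: f u v w + f u' v w.
Proof. by case: f_lin => h _ _; exact: (h v w). Qed.

Lemma trilinear2P a u v v' w : f u (a *: v + v') w = a *: f u v w + f u v' w.
Proof. by case: f_lin => _ h _; exact: (h u w). Qed.

Lemma trilinear3P a u v w w' : f u v (a *: w + w') = a *: f u v w + f u v w'.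
Proof. by case: f_lin => _ _ h; exact: (h u v). Qed.

Lemma trilinearD1 u u' v w : f (u + u') v w = f u v w + f u' v w.
Proof. by rewrite -[u]scale1r trilinear1P !scale1r. Qed.

Lemma trilinearD2 u v v' w : f u (v + v') w = f u v w + f u v' w.
Proof. by rewrite -[v]scale1r trilinear2P !scale1r. Qed.

Lemma trilinearD3 u v w w' : f u v (w + w') = f u v w + f u v w'.
Proof. by rewrite -[w]scale1r trilinear3P !scale1r. Qed.

End TrilinearMaps.

Lemma addr3ACA (V : nmodType) (a b c a' b' c' : V) :
  (a + b + c) + (a' + b' + c') = (a + a') + (b + b') + (c + c').
Proof. by rewrite addrACA (addrACA a). Qed.

Lemma addr4ACA (V : nmodType) (a b c d a' b' c' d' : V) :
  (a + b + c + d) + (a' + b' + c' + d') =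
  (a + a') + (b + b') + (c + c') + (d + d').
Proof. by rewrite addrACA addr3ACA. Qed.

Section TwistedBracket.

Set Implicit Arguments.
Unset Strict Implicit.

Variables (K : fieldType) (L M : lmodType K) (br : L -> L -> L -> L).
Variables (l1 : M -> L -> L -> M) (l2 : L -> M -> L -> M).
Variable l3 : L -> L -> M -> M.
Hypotheses (hL : ternary_leibniz br) (hM : bimodule br l1 l2 l3).

Let l1D := trilinearD1 (bimodule_trilinear1 hM).
Let l2D := trilinearD2 (bimodule_trilinear2 hM).
Let l3D := trilinearD3 (bimodule_trilinear3 hM).

Local Notation twist := (twisted_bracket br l1 l2 l3).

Lemma twisted_trilinear (omega : L -> L -> L -> M) :
  trilinear omega -> trilinear (twist omega).
Proof.
have [br_lin _] := hL; have [lin1 lin2 lin3 _ _ _ _ _] := hM => omega_lin.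
split=> [[? ?] [? ?]|[? ?] [? ?]|[? ?] [? ?]] a [? ?] [? ?];
  rewrite /twisted_bracket /=; congr pair => /=.
- exact: trilinear1P.
- rewrite (trilinear1P lin1) (trilinear1P lin2) (trilinear1P lin3).
  by rewrite (trilinear1P omega_lin) !scalerDr -addr4ACA.
- exact: trilinear2P.
- rewrite (trilinear2P lin1) (trilinear2P lin2) (trilinear2P lin3).
  by rewrite (trilinear2P omega_lin) !scalerDr -addr4ACA.
- exact: trilinear3P.
- rewrite (trilinear3P lin1) (trilinear3P lin2) (trilinear3P lin3).
  by rewrite (trilinear3P omega_lin) !scalerDr -addr4ACA.
Qed.

Lemma twisted_leibniz_identity (omega : L -> L -> L -> M) (a b c d e : L * M) :
  cocycle2 br l1 l2 l3 omega ->
  twist omega (twist omega a b c) d e =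
    twist omega a b (twist omega c d e) + twist omega a (twist omega b d e) c
    + twist omega (twist omega a d e) b c.
Proof.
case: a b c d e => [x m1] [y m2] [z m3] [t m4] [u m5] [_ omegaE].
rewrite /twisted_bracket /=; congr pair => /=; first exact: leibniz_identity.
rewrite !l1D !l2D !l3D.
(* One group for each of [m1], ..., [m5] and a last one for [omega]. *)
rewrite [LHS](ACl (1*2*3*5*6*(4*7)))/=.
(* The axioms for [l1] produce further instances of [l2] and [l3] at a bracket,
   which must stay as they are. *)
rewrite (bimodule_l2 hM _ x y z) (bimodule_l3 hM _ x y z) omegaE.
rewrite (bimodule_l1l1 hM) (bimodule_l1l2 hM) (bimodule_l1l3 hM).
(* The terms of [m1] are now numbered 1 to 3, ..., those of [m5] 13 to 15, the
   nested and plain ones of [omega] 16 to 18 and 19 to 21.  The [k]-th term of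
   each triple comes from the [k]-th nested bracket on the right. *)
rewrite !addrA [LHS](ACl ((1*4*7*10*13*16*19)*(2*5*11*14*17*8*20)
                         *(3*12*15*18*6*9*21)))/=.
by rewrite !addrA.
Qed.

Lemma twisted_leibniz (omega : L -> L -> L -> M) :
  cocycle2 br l1 l2 l3 omega -> ternary_leibniz (twist omega).
Proof.
move=> homega; split; first exact/twisted_trilinear/(cocycle2_trilinear homega).
by move=> *; exact: twisted_leibniz_identity.
Qed.

Lemma cocycle2_0 : cocycle2 br l1 l2 l3 (fun _ _ _ => 0).
Proof.
split=> [|x y z t u].
  by split=> v w a p q; rewrite /= scaler0 addr0.
have l10 v w : l1 0 v w = 0 by apply: (addrI (l1 0 v w)); rewrite -l1D !addr0.
have l20 v w : l2 v 0 w = 0 by apply: (addrI (l2 v 0 w)); rewrite -l2D !addr0.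
have l30 v w : l3 v w 0 = 0 by apply: (addrI (l3 v w 0)); rewrite -l3D !addr0.
by rewrite /= !l10 l20 l30 !addr0.
Qed.

(** The outer bracket contributes its own twist evaluated at [L]-components,
    which do not depend on the inner twist; hence the outer twists of the two
    summands can be exchanged. *)
Lemma twisted_polar1 (omega omega' : L -> L -> L -> M) (a b c d e : L * M) :
  twist omega' (twist omega a b c) d e + twist omega (twist omega' a b c) d e =
  twist omega (twist omega a b c) d e + twist omega' (twist omega' a b c) d e.
Proof.
rewrite /twisted_bracket /=; congr pair => /=.
set m := l1 a.2 _ _ + _ + _; rewrite !(l1D m) !addrA.
(* Terms 5 and 10 are the outer twists. *)
by rewrite [LHS](ACl (1*2*3*4*10*6*7*8*9*5))/=.
Qed.

Lemma twisted_polar2 (omega omega' : L -> L -> L -> M) (a b c d e : L * M) :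
  twist omega' a (twist omega b c d) e + twist omega a (twist omega' b c d) e =
  twist omega a (twist omega b c d) e + twist omega' a (twist omega' b c d) e.
Proof.
rewrite /twisted_bracket /=; congr pair => /=.
set m := l1 b.2 _ _ + _ + _; rewrite !(l2D _ m) !addrA.
by rewrite [LHS](ACl (1*2*3*4*10*6*7*8*9*5))/=.
Qed.

Lemma twisted_polar3 (omega omega' : L -> L -> L -> M) (a b c d e : L * M) :
  twist omega' a b (twist omega c d e) + twist omega a b (twist omega' c d e) =
  twist omega a b (twist omega c d e) + twist omega' a b (twist omega' c d e).
Proof.
rewrite /twisted_bracket /=; congr pair => /=.
set m := l1 c.2 _ _ + _ + _; rewrite !(l3D _ _ m) !addrA.
by rewrite [LHS](ACl (1*2*3*4*10*6*7*8*9*5))/=.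
Qed.

Lemma twisted_compatible (omega omega' : L -> L -> L -> M) :
    cocycle2 br l1 l2 l3 omega -> cocycle2 br l1 l2 l3 omega' ->
  compatible (twist omega) (twist omega').
Proof.
move=> homega homega'; split=> [||a b c d e]; try exact: twisted_leibniz.
rewrite twisted_polar1 -(addrA (_ + _) (twist omega' a _ c)).
rewrite -(addrA _ (twist omega' _ b c)) twisted_polar1 twisted_polar2.
rewrite twisted_polar3 (twisted_leibniz_identity a b c d e homega).
by rewrite (twisted_leibniz_identity a b c d e homega') addr3ACA.
Qed.

End TwistedBracket.

Theorem theorem4p1 (K : fieldType) (L M : lmodType K)
    (br : L -> L -> L -> L)
    (l1 : M -> L -> L -> M) (l2 : L -> M -> L -> M) (l3 : L -> L -> M -> M)
    (omega : L -> L -> L -> M)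
    (hL : ternary_leibniz br) (hM : bimodule br l1 l2 l3)
    (homega : cocycle2 br l1 l2 l3 omega) :
  ternary_leibniz (twisted_bracket br l1 l2 l3 omega) /\
  compatible (twisted_bracket br l1 l2 l3 (fun _ _ _ => 0))
             (twisted_bracket br l1 l2 l3 omega).
Proof.
split; first exact: twisted_leibniz.
exact: (twisted_compatible hL hM (cocycle2_0 hM)).
Qed.
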